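(* Let $\alpha,\beta,\gamma>0$, let $\mu$ be a positive Borel measure on $[0,1)$, and suppose that $\mathcal{H}_{\mu,\alpha}$ is a bounded operator from $\mathscr{B}_{\beta}$ into $\mathscr{B}_{\gamma}$. (i) If $1<\beta<\infty$, then $\mu$ is an $(\alpha+\beta-\gamma-1/2)$-Carleson measure if $\alpha+\beta-\gamma-1/2>0$, and $\mu$ is finite if $\alpha+\beta-\gamma-1/2=0$. (ii) If $0<\beta<1$, then $\mu$ is an $(\alpha-\gamma+1/2)$-Carleson measure if $\alpha-\gamma+1/2>0$, and $\mu$ is finite if $\alpha-\gamma+1/2=0$.
   Context: $\mathbb{D}$ is the open unit disc, $H(\mathbb{D})$ the analytic functions on $\mathbb{D}$. For $\alpha>0$, the Bloch type space $\mathscr{B}_{\alpha}$ is the set of $f\in H(\mathbb{D})$ with $\|f\|_{\mathscr{B}_\alpha}=\sup_{z\in\mathbb{D}}(1-|z|^2)^{\alpha}|f'(z)|<\infty$; it is a Banach space with norm $|f(0)|+\|f\|_{\mathscr{B}_\alpha}$. For a positive Borel measure $\mu$ on $[0,1)$ and $\alpha>0$ put $\mu_{n,k,\alpha}=\int_{[0,1)}\frac{\Gamma(n+\alpha)}{n!\,\Gamma(\alpha)}t^{n+k}\,d\mu(t)$ for $n,k\ge 0$, and for $f(z)=\sum_{k\ge0}a_kz^k\in H(\mathbb{D})$ define $\mathcal{H}_{\mu,\alpha}(f)(z)=\sum_{n=0}^\infty\big(\sum_{k=0}^\infty\mu_{n,k,\alpha}a_k\big)z^n$ whenever the right-hand side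 makes sense (the numbers $\mu_{n,k,\alpha}$ are finite and the inner series converge) and defines an analytic function in $\mathbb{D}$. Saying that $\mathcal{H}_{\mu,\alpha}$ is a bounded operator from $X$ into $Y$ includes that it is well defined in this sense on every $f\in X$. For $s>0$, a positive Borel measure $\mu$ on $[0,1)$ is an $s$-Carleson measure if there is $C>0$ with $\mu([t,1))\le C(1-t)^s$ for all $0\le t<1$. *)

(* Defs.v *)
From mathcomp Require Import all_boot all_order all_algebra.
From mathcomp Require Import all_classical all_reals all_analysis.
From mathcomp Require Import complex.

Set Implicit Arguments.
Unset Strict Implicit.
Unset Printing Implicit Defensive.

Import Order.TTheory GRing.Theory Num.Theory.
Import numFieldNormedType.Exports.

Local Open Scope classical_set_scope.
Local Open Scope ring_scope.

(* R[i] is packed as a numFieldType so that it receives the topology and the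
   (complex) derivative that MathComp-Analysis attaches to numFieldTypes. *)
Definition cplx (R : realType) : numFieldType := R[i].

(* The modulus with values in R; `|z| is the same number seen in R[i]. *)
Definition cabs (R : realType) (z : cplx R) : R := Normc.normc z.

Definition ofR (R : realType) (x : R) : cplx R := real_complex R x.

Definition disc (R : realType) : set (cplx R) := [set z | cabs z < 1].
Arguments disc : clear implicits.

(* H(D). Functions on D are represented by functions on the whole plane;
   every notion below depends only on the restriction to D (the derivative at
   a point of D is local and D is open). *)
Definition holomorphic_disc (R : realType) (f : cplx R -> cplx R) : Prop :=
  forall z, disc R z -> derivable f z 1.

Definition power_series_on_disc (R : realType)
    (a : nat -> cplx R) (f : cplx R -> cplx R) : Prop :=
  forall z, disc R z -> series (fun k => a k * z ^+ k) @ \oo --> f z.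

Definition bloch_seminorm (R : realType) (b : R) (f : cplx R -> cplx R) : \bar R :=
  ereal_sup [set ((1 - cabs z ^+ 2) `^ b * cabs (derive1 f z))%:E | z in disc R].

Definition bloch (R : realType) (b : R) (f : cplx R -> cplx R) : Prop :=
  holomorphic_disc f /\ (bloch_seminorm b f < +oo)%E.

Definition bloch_norm (R : realType) (b : R) (f : cplx R -> cplx R) : \bar R :=
  ((cabs (f 0))%:E + bloch_seminorm b f)%E.

Definition Gamma (R : realType) (x : R) : R :=
  \int[@lebesgue_measure R]_(t in `]0, +oo[) (t `^ (x - 1) * expR (- t)).

(* Here and below, a Borel measure on [0,1) is given as a Borel measure on R of
   which only the restriction to [0,1) is used. *)
Definition moment (R : realType) (mu : {measure set (measurableTypeR R) -> \bar R})
    (alpha : R) (n k : nat) : \bar R :=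
  (\int[mu]_(t in `[0%R, 1%R[)
     (Gamma (n%:R + alpha) / (n`!%:R * Gamma alpha) * t ^+ (n + k))%:E)%E.

Section Hankel.
Context (R : realType) (mu : {measure set (measurableTypeR R) -> \bar R}).
Context (alpha : R).

Definition hankel_inner (a : nat -> cplx R) (n : nat) : (cplx R)^nat :=
  series (fun k => ofR (fine (moment mu alpha n k)) * a k).

Definition hankel_outer (a : nat -> cplx R) (z : cplx R) : (cplx R)^nat :=
  series (fun n => limn (hankel_inner a n) * z ^+ n).

(* H_{mu,alpha}(f), as a function of the Taylor coefficients a of f. *)
Definition hankel (a : nat -> cplx R) (z : cplx R) : cplx R :=
  limn (hankel_outer a z).

Definition hankel_defined (a : nat -> cplx R) : Prop :=
  [/\ forall n k, (moment mu alpha n k < +oo)%E,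
      forall n, cvgn (hankel_inner a n),
      forall z, disc R z -> cvgn (hankel_outer a z) &
      holomorphic_disc (hankel a)].

(* The Taylor coefficients of f are the a with f(z) = sum_k a_k z^k on D;
   they exist and are unique for f in H(D). *)
Definition hankel_bounded (beta gamma : R) : Prop :=
  exists M : R, forall (f : cplx R -> cplx R) (a : nat -> cplx R),
    bloch beta f -> power_series_on_disc a f ->
    [/\ hankel_defined a, bloch gamma (hankel a) &
        (bloch_norm gamma (hankel a) <= M%:E * bloch_norm beta f)%E].

End Hankel.

Definition carleson (R : realType) (s : R)
    (mu : {measure set (measurableTypeR R) -> \bar R}) : Prop :=
  exists2 C : R, 0 < C &
    forall t : R, 0 <= t < 1 -> (mu `[t, 1%R[%classic <= (C * (1 - t) `^ s)%:E)%E.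

(* Main.v *)
(* The test functions are the monomials f(z) = z^N, N >= 1: their Bloch norm is
   O(N^(1 - beta)), and H f is the power series with nonnegative coefficients
   moment n N >= c_n b^(n + N) mu [b, 1), c_n = Gamma(n + alpha) / (n! Gamma alpha).
   Since sum_n n c_n y^(n - 1) >= const (1 - y)^(- alpha - 1), evaluating (H f)'
   at z = b gives
     b^(N + 1) mu [b, 1) <= C (1 - b^2)^(alpha + 1 - gamma) N^(1 - beta).
   Taking N comparable to 1 / (1 - b^2), respectively N = 1, bounds mu [b, 1) by
   (1 - b)^(alpha + beta - gamma), respectively (1 - b)^(alpha + 1 - gamma);
   both exponents exceed the required one by 1/2.  Finiteness of mu is that of
   the moment with n = k = 0. *)
Require Import Defs.
From mathcomp Require Import all_boot all_order all_algebra.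
From mathcomp Require Import all_classical all_reals all_analysis.
From mathcomp Require Import measurable_realfun complex ring lra.

Set Implicit Arguments.
Unset Strict Implicit.
Unset Printing Implicit Defensive.

Import Order.TTheory GRing.Theory Num.Theory.
Import numFieldNormedType.Exports.

Local Open Scope classical_set_scope.
Local Open Scope ring_scope.

(** * Convergence and positivity of the Gamma integral *)

(** Write t = a (t / a) and raise t / a <= exp (t / a) to the power a. *)
Lemma powR_le_expR (R : realType) (a t : R) : 0 < a -> 0 <= t ->
  t `^ a <= a `^ a * expR t.
Proof.
move=> a0 t0.
have tE : t = a * (t / a) by rewrite mulrC divfK// gt_eqF.
rewrite [leLHS](_ : _ = (a * (t / a)) `^ a); last by rewrite -tE.
rewrite powRM ?divr_ge0 ?(ltW a0)//.
rewrite ler_pM2l ?powR_gt0//.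
have -> : expR t = expR (t / a) `^ a by rewrite -expRM divfK// gt_eqF.
apply: ge0_ler_powR; rewrite ?nnegrE ?(ltW a0) ?divr_ge0 ?expR_ge0 ?(ltW a0)//.
by apply: le_trans (expR_ge1Dx _); rewrite lerDr.
Qed.

Section gamma_integrand.
Context {R : realType}.
Implicit Types a t p q : R.

Definition gamma_fun a t := t `^ (a - 1) * expR (- t).

Lemma gamma_fun_ge0 a t : 0 <= gamma_fun a t.
Proof. by rewrite mulr_ge0 ?powR_ge0 ?expR_ge0. Qed.

Lemma measurable_gamma_fun a (D : set R) : measurable_fun D (gamma_fun a).
Proof.
apply: measurable_funTS; apply: measurable_funM.
  exact: measurable_powR.
by apply: measurableT_comp => //; exact: measurable_expR.
Qed.

(* The derivative of this bounded function dominates the Gamma integrand up to a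
   constant, at 0 and at +oo simultaneously. *)
Let logistic a t := - (1 + t `^ a)^-1.

Let is_derive_logistic a t : 0 < t ->
  is_derive t 1 (logistic a) (a * t `^ (a - 1) / (1 + t `^ a) ^+ 2).
Proof.
move=> t0.
have n0 : 1 + t `^ a != 0 by rewrite gt_eqF// ltr_pwDl// powR_ge0.
have dp := is_derive1_powR a t0.
have d1 : is_derive t 1 (fun u => 1 + u `^ a) (a * t `^ (a - 1)).
  have /= := is_deriveD (is_derive_cst (1 : R^o) t 1) dp.
  by rewrite add0r.
have dD : derivable (fun u => 1 + u `^ a) t 1 by apply: ex_derive.
have dV : derivable (fun u => (1 + u `^ a)^-1) t 1 by exact: derivableV.
split; first by apply: derivableN.
rewrite deriveN// deriveV//.
rewrite derive_val -mulNr opprK.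
by rewrite mulrC.
Qed.

(** The integrand is the derivative of [logistic a], whose values lie in [-1, 0]; the bound is thus
    uniform in both endpoints. *)
Let logistic_itv a p q : 0 < p -> p < q ->
  (\int[@lebesgue_measure R]_(t in `[p, q])
     (a * t `^ (a - 1) / (1 + t `^ a) ^+ 2)%:E <= 1)%E.
Proof.
move=> p0 pq.
have dL t : t \in `[p, q] -> derivable (logistic a) t 1.
  rewrite in_itv/= => /andP[pt _].
  by have [] := is_derive_logistic a (lt_le_trans p0 pt).
have dp t : t \in `[p, q] -> derivable (fun u : R => u `^ a) t 1.
  rewrite in_itv/= => /andP[pt _].
  by have [] := is_derive1_powR a (lt_le_trans p0 pt).
have dp1 t : t \in `[p, q] -> derivable (fun u : R => u `^ (a - 1)) t 1.
  rewrite in_itv/= => /andP[pt _].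
  by have [] := is_derive1_powR (a - 1) (lt_le_trans p0 pt).
have /(continuous_within_itvP _ pq)[cLo cLr cLl] :=
  derivable_within_continuous dL.
rewrite (@continuous_FTC2 _ _ (logistic a))//.
- rewrite -EFinD lee_fin /logistic opprK.
  have := powR_ge0 q a; have := powR_ge0 p a => pa qa.
  have : 0 <= (1 + q `^ a)^-1 by rewrite invr_ge0 addr_ge0.
  suff : (1 + p `^ a)^-1 <= 1 by lra.
  by rewrite invf_le1 ?lerDl// ltr_pwDl.
- apply: derivable_within_continuous => t tpq.
  apply: derivableM; first by apply: derivableM => //; exact: dp1.
  have n0 : 1 + t `^ a != 0 by rewrite gt_eqF// ltr_pwDl// powR_ge0.
  apply: derivableV; first by rewrite expf_neq0.
  have d1 : derivable (fun u : R => 1 + u `^ a) t 1.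
    by apply: derivableD => //; exact: dp.
  exact: (derivableM d1 d1).
- by split => // t tpq; apply: dL; exact: subset_itv_oo_cc.
- move=> t; rewrite in_itv/= => /andP[pt _].
  have [_] := is_derive_logistic a (lt_trans p0 pt).
  by rewrite derive1E.
Qed.

(** With x = t^a, this amounts to (1 + x)^2 <= 2 + 2 x^2 <= (2 + 2 K) exp t, where x^2 = t^(2a) <= K
    exp t by [powR_le_expR]. *)
Let gamma_fun_le a : 0 < a -> exists2 C : R, 0 < C &
  forall t, 0 < t -> gamma_fun a t <= C * (a * t `^ (a - 1) / (1 + t `^ a) ^+ 2).
Proof.
move=> a0; set K := (a * 2) `^ (a * 2).
have K0 : 0 < K by rewrite powR_gt0// mulr_gt0.
exists ((2 + 2 * K) / a); first by rewrite divr_gt0// addr_gt0// mulr_gt0.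
move=> t t0; rewrite /gamma_fun.
have n0 : 0 < (1 + t `^ a) ^+ 2 by rewrite exprn_gt0// ltr_pwDl// powR_ge0.
rewrite [leRHS](_ : _ = t `^ (a - 1) * ((2 + 2 * K) / (1 + t `^ a) ^+ 2)); last first.
  by field; rewrite !gt_eqF// ltr_pwDl// powR_ge0.
rewrite ler_wpM2l ?powR_ge0// ler_pdivlMr// expRN ler_pdivrMl ?expR_gt0//.
have e1 : 1 <= expR t by rewrite (le_trans _ (expR_ge1Dx _))// lerDl ltW.
have := powR_le_expR (mulr_gt0 a0 (ltr0n _ 2)) (ltW t0).
rewrite powRrM -/K (_ : 2 = 2%:R :> R)// powR_mulrn ?powR_ge0//.
move: (t `^ a) (expR t) e1 => x y y1 xy.
have := sqr_ge0 (1 - x); nra.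
Qed.

Lemma gamma_fun_integral_lty a : 0 < a ->
  (\int[@lebesgue_measure R]_(t in `]0%R, +oo[) (gamma_fun a t)%:E < +oo)%E.
Proof.
move=> a0; have [C C0 HC] := gamma_fun_le a0.
(* Monotone convergence along compact intervals; starting at 2 keeps the endpoints distinct already
   for n = 0. *)
pose F n := `[n.+2%:R^-1, n.+2%:R]%classic : set R.
have n1 n : n.+2%:R^-1 < n.+2%:R :> R.
  by rewrite (@lt_trans _ _ 1) ?invf_lt1 ?ltr1n.
have -> : `]0, +oo[%classic = \bigcup_n F n.
  apply/seteqP; split => t /=; rewrite in_itv/= ?andbT.
    move=> t0; have ti0 : 0 < t^-1 by rewrite invr_gt0.
    have := archi_boundP (addr_ge0 (ltW t0) (ltW ti0)).
    move: (Num.Def.archi_bound _) => m Hm; exists m => //.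
    have m2 : t + t^-1 <= m.+2%:R :> R.
      by rewrite (le_trans (ltW Hm))// ler_nat -addn2 leq_addr.
    rewrite /F/= in_itv/= invf_ple ?posrE//.
    by apply/andP; split; apply: le_trans m2; rewrite ?lerDl ?lerDr ltW.
  move=> [n _]; rewrite /F/= in_itv/= => /andP[+ _].
  by apply: lt_le_trans; rewrite invr_gt0.
have cF : (\int[lebesgue_measure]_(t in F n) (gamma_fun a t)%:E)%E @[n --> \oo]
    --> (\int[@lebesgue_measure R]_(t in \bigcup_n F n) (gamma_fun a t)%:E)%E.
  apply: ge0_nondecreasing_set_cvg_integral.
  - move=> m n mn; apply/subsetPset; apply: subset_itv; rewrite bnd_simp.
      by rewrite lef_pV2 ?posrE// ler_nat !ltnS.
    by rewrite ler_nat !ltnS.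
  - by move=> n; exact: measurable_itv.
  - by move=> n; apply/measurable_EFinP; exact: measurable_gamma_fun.
  - by move=> n t _; rewrite lee_fin gamma_fun_ge0.
apply: (@le_lt_trans _ _ C%:E); last by rewrite ltry.
have mL (D : set R) :
    measurable_fun D (fun t : R => a * t `^ (a - 1) / (1 + t `^ a) ^+ 2).
  apply: measurable_funTS; apply: measurable_funM.
    by apply: measurable_funM => //; exact: measurable_powR.
  rewrite (_ : (fun _ => _) = fun t : R => (1 + t `^ a) `^ (- 2%:R)).
    apply: (measurableT_comp (measurable_powR _)).
    by apply: measurable_funD => //; exact: measurable_powR.
  by apply/funext => t; rewrite powR_invn// addr_ge0// powR_ge0.
move/cvg_lim : (cF) => <- //; apply: lime_le; first by apply/cvg_ex; eexists; exact: cF.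
near=> n.
apply: (@le_trans _ _ (\int[lebesgue_measure]_(t in F n)
   (C%:E * (a * t `^ (a - 1) / (1 + t `^ a) ^+ 2)%:E))%E).
  apply: ge0_le_integral => //=.
  - exact: measurable_itv.
  - by move=> t _; rewrite lee_fin gamma_fun_ge0.
  - by apply/measurable_EFinP; exact: measurable_gamma_fun.
  - by apply/measurable_EFinP; apply: measurable_funM => //; exact: mL.
  - move=> t; rewrite /F/= in_itv/= => /andP[nt _]; rewrite lee_fin HC//.
    by rewrite (lt_le_trans _ nt)// invr_gt0.
rewrite ge0_integralZl_EFin//; last exact: ltW.
- rewrite -[leRHS]mule1; apply: lee_wpmul2l; first by rewrite lee_fin ltW.
  by rewrite logistic_itv ?invr_gt0.
- exact: measurable_itv.
- by move=> t _; rewrite lee_fin divr_ge0 ?exprn_ge0 ?addr_ge0 ?mulr_ge0 ?powR_ge0 ?(ltW a0).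
- by apply/measurable_EFinP; exact: mL.
Unshelve. all: by end_near. Qed.

Lemma gamma_fun_integral_gt0 a : 0 < a ->
  (0 < \int[@lebesgue_measure R]_(t in `]0%R, +oo[) (gamma_fun a t)%:E)%E.
Proof.
(* On [1, 2], t^(a - 1) >= 1 / t >= 1 / 2 and exp (- t) >= exp (- 2). *)
move=> a0; apply: (@lt_le_trans _ _ (\int[lebesgue_measure]_(t in `[1%R, 2%R])
   (cst (expR (- 2) / 2)%:E t))%E).
  rewrite integral_cst//=; rewrite lebesgue_measure_itv/= lte_fin ltr1n -EFinD.
  by rewrite -EFinM lte_fin !mulr_gt0 ?expR_gt0 ?invr_gt0//; lra.
apply: (@le_trans _ _ (\int[lebesgue_measure]_(t in `[1%R, 2%R])
   (gamma_fun a t)%:E)%E).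
  apply: ge0_le_integral => //=.
  - by apply/measurable_EFinP; exact: measurable_gamma_fun.
  - move=> t; rewrite in_itv/= => /andP[t1 t2]; rewrite lee_fin /gamma_fun mulrC.
    apply: ler_pM; rewrite ?invr_ge0 ?expR_ge0//; last by rewrite ler_expR lerN2.
    apply: (@le_trans _ _ (t `^ (-1))); last by rewrite ler_powR//; lra.
    by rewrite powR_inv1 ?lef_pV2 ?posrE//; lra.
apply: ge0_subset_integral => //=.
- by apply/measurable_EFinP; exact: measurable_gamma_fun.
- by move=> t _; rewrite lee_fin gamma_fun_ge0.
- by apply: subset_itv; rewrite bnd_simp.
Qed.

(** [Gamma] is a real-valued integral, which would be 0 if the extended one were infinite;
    finiteness makes the two agree. *)
Lemma GammaE a : 0 < a -> (Gamma a)%:E =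
  (\int[@lebesgue_measure R]_(t in `]0%R, +oo[) (gamma_fun a t)%:E)%E.
Proof.
move=> a0; rewrite /Gamma /Rintegral fineK// ge0_fin_numE ?gamma_fun_integral_lty//.
by rewrite ltW// gamma_fun_integral_gt0.
Qed.

Lemma Gamma_gt0 a : 0 < a -> 0 < Gamma a.
Proof. by move=> a0; rewrite -lte_fin GammaE// gamma_fun_integral_gt0. Qed.
End gamma_integrand.

(** * Lower bound for a power series with Gamma coefficients *)

Lemma expR_nneseries (R : realType) (x : R) :
  (\sum_(0 <= n <oo) (x ^+ n / n`!%:R)%:E)%E = (expR x)%:E.
Proof.
rewrite /expR -EFin_lim; last exact: is_cvg_series_exp_coeff.
apply: congr_lim; apply/funext => n /=.
by rewrite sumEFin.
Qed.

Section gamma_series.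
Context {R : realType}.
Implicit Types a y t : R.

Lemma gamma_funS n a t : 0 < t ->
  gamma_fun (n.+1%:R + a) t = t ^+ n * (t `^ a * expR (- t)).
Proof.
move=> t0; rewrite /gamma_fun mulrA; congr (_ * _).
have -> : n.+1%:R + a - 1 = n%:R + a by rewrite -natr1; ring.
by rewrite powRD ?(gt_eqF t0) ?implybT// powR_mulrn ?(ltW t0).
Qed.

(* The sum is Gamma(a + 1) (1 - y)^(- a - 1); keeping only the window
   [1 / (1 - y), 2 / (1 - y)] of the integral avoids a change of variables. *)
Lemma Gamma_series_ge a y : 0 < a -> 0 <= y < 1 ->
  ((expR (- 2) * ((1 - y)^-1) `^ (a + 1))%:E <=
   \sum_(0 <= n <oo) (Gamma (n.+1%:R + a) / n`!%:R * y ^+ n)%:E)%E.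
Proof.
move=> a0 /andP[y0 y1].
pose g n t := ((y ^+ n / n`!%:R)%:E * (gamma_fun (n.+1%:R + a) t)%:E)%E.
have y1' : 0 < 1 - y by rewrite subr_gt0.
set w := (1 - y)^-1.
have w0 : 0 < w by rewrite invr_gt0.
have g0 n t : (0 <= g n t)%E.
  by rewrite mule_ge0// lee_fin ?gamma_fun_ge0// divr_ge0// exprn_ge0.
have mg n (D : set R) : measurable_fun D (g n).
  apply: emeasurable_funM => //.
  by apply/measurable_EFinP; exact: measurable_gamma_fun.
(* Tonelli: all terms are nonnegative, so sum and integral commute. *)
rewrite (_ : (\sum_(0 <= n <oo) _)%E =
    (\int[@lebesgue_measure R]_(t in `]0%R, +oo[) \sum_(0 <= n <oo) g n t)%E); last first.
  rewrite integral_nneseries//; last by move=> n; exact: mg.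
  apply: congr_lim; apply/funext => m; apply: eq_bigr => n _.
  rewrite ge0_integralZl_EFin//.
  - rewrite -GammaE; last by rewrite ltr_wpDl.
    by rewrite -EFinM; congr EFin; ring.
  - by move=> t _; rewrite lee_fin gamma_fun_ge0.
  - by apply/measurable_EFinP; exact: measurable_gamma_fun.
  - by rewrite divr_ge0 ?exprn_ge0.
have ms (D : set R) : measurable D ->
    measurable_fun D (fun t => \sum_(0 <= n <oo) g n t)%E.
  by move=> mD; apply: ge0_emeasurable_sum.
apply: (@le_trans _ _ (\int[@lebesgue_measure R]_(t in `[w, (2 * w)%R])
    \sum_(0 <= n <oo) g n t)%E); last first.
  apply: ge0_subset_integral => //=; first exact: ms.
    by move=> t _; exact: nneseries_ge0.
  by apply: subset_itv; rewrite bnd_simp.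
apply: (@le_trans _ _ (\int[@lebesgue_measure R]_(t in `[w, (2 * w)%R])
    (cst (w `^ a * expR (- 2))%:E t))%E).
  rewrite integral_cst//= lebesgue_measure_itv/= lte_fin ifT; last by lra.
  rewrite -EFinD -EFinM lee_fin.
  rewrite (@powRD _ w) ?(gt_eqF w0) ?implybT// (powRr1 (ltW w0)).
  by rewrite le_eqVlt; apply/orP; left; apply/eqP; ring.
apply: ge0_le_integral => //=.
- by move=> t _; rewrite lee_fin mulr_ge0 ?powR_ge0 ?expR_ge0.
- exact: ms.
move=> t; rewrite in_itv/= => /andP[wt t2w].
have t0 : 0 < t by exact: lt_le_trans wt.
(* The exponential series leaves t^a exp (- t (1 - y)); on the window t >= w and t (1 - y) <= 2, and
   the window has length w. *)
have -> : (\sum_(0 <= n <oo) g n t)%E = (t `^ a * expR (- t) * expR (t * y))%:E.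
  rewrite EFinM -expR_nneseries -nneseriesZl; last first.
    by move=> n _; rewrite lee_fin divr_ge0 ?exprn_ge0 ?mulr_ge0 ?(ltW t0).
  apply: congr_lim; apply/funext => m; apply: eq_bigr => n _.
  by rewrite /g gamma_funS// -!EFinM exprMn; congr EFin; ring.
rewrite lee_fin -mulrA -expRD ler_pM ?powR_ge0 ?expR_ge0//.
  by rewrite ge0_ler_powR ?nnegrE// ltW.
rewrite ler_expR.
have : t * (1 - y) <= 2 * w * (1 - y) by rewrite ler_pM2r.
by rewrite /w -mulrA mulVf ?gt_eqF//; lra.
Qed.
End gamma_series.

(** * The real-valued modulus and limits of complex sequences *)

Section cabs.
Context {R : realType}.
Implicit Types (z w : cplx R) (x : R).

Lemma cabsE z : ofR (cabs z) = `|z|.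
Proof. by []. Qed.

Lemma ofR_lt x y : (ofR x < ofR y) = (x < y).
Proof. by rewrite /ofR ltcR. Qed.

Lemma cabsM z w : cabs (z * w) = cabs z * cabs w.
Proof. exact: Normc.normcM. Qed.

Lemma cabs0 : cabs (0 : cplx R) = 0.
Proof. exact: Normc.normc0. Qed.

Lemma cabsX z n : cabs (z ^+ n) = cabs z ^+ n.
Proof.
elim: n => [|n IHn]; first by rewrite !expr0 /cabs Normc.normc1.
by rewrite !exprS cabsM IHn.
Qed.

Lemma cabsMn z n : cabs (z *+ n) = cabs z *+ n.
Proof. exact: normcMn. Qed.

Lemma cabs_ge0 z : 0 <= cabs z.
Proof. by rewrite -ler0c -/(ofR _) cabsE. Qed.

Lemma le_cabsD z w : cabs (z + w) <= cabs z + cabs w.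
Proof. exact: le_normcD. Qed.

Lemma cabs_ofR x : 0 <= x -> cabs (ofR x) = x.
Proof.
by move=> x0; rewrite /cabs/= expr0n/= addr0 sqrtr_sqr ger0_norm.
Qed.

(** Stated for a general filter because it serves both for difference quotients as h tends to 0+ and
    for partial sums. *)
Lemma cvg_cabs_ge (T : Type) (F : set_system T) (FF : ProperFilter F)
    (u : T -> cplx R) (l : cplx R) (s : R) :
  u x @[x --> F] --> l -> (\forall x \near F, s <= cabs (u x)) -> s <= cabs l.
Proof.
move=> ul su; apply/ler_addgt0Pr => e e0.
have e0' : 0 < ofR e by rewrite /ofR ltcR.
(* The inequality does not involve [x]; properness of [F] provides one [x] from which to read it
   off. *)
have : \forall x \near F, False \/ s <= cabs l + e.
  move/cvgrPdist_lt : ul => /(_ _ e0') ul; near=> x; right.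
  have ux : cabs (u x - l) < e.
    rewrite -ofR_lt cabsE distrC; near: x; exact: ul.
  apply: (@le_trans _ _ (cabs (u x))); first by near: x.
  rewrite -[u x](subrK l) (le_trans (le_cabsD _ _))//.
  by rewrite addrC lerD2l ltW.
by move=> /filter_ex[x []].
Unshelve. all: by end_near. Qed.

(** The partial sums are constant from N + 1 on. It handles both the Taylor series of z^N and the
    inner Hankel series. *)
Lemma cvg_series_single (u : nat -> cplx R) N :
  series (fun k => u k * (k == N)%:R) @ \oo --> u N.
Proof.
apply: cvg_near_cst; near=> n; rewrite /series/=.
have Nn : (N < n)%N by near: n; exact: nbhs_infty_gt.
rewrite big_mkord (bigD1 (Ordinal Nn))//= eqxx mulr1 big1 ?addr0// => i iN.
suff -> : (i == N :> nat) = false by rewrite mulr0.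
by apply: contra_neqF iN => /eqP iN; exact: val_inj.
Unshelve. all: by end_near. Qed.

End cabs.

(** * Bloch norms of the monomials *)

Section monomial.
Context {R : realType}.

Lemma monomial_power_series N :
  power_series_on_disc (fun k => (k == N)%:R) (fun z : cplx R => z ^+ N).
Proof.
move=> z _; rewrite /mkset.
rewrite (_ : (fun k => _) = (fun k => z ^+ k * (k == N)%:R)); last first.
  by apply/funext => k; rewrite mulrC.
exact: (@cvg_series_single R (fun k => z ^+ k)).
Qed.

Lemma cabs_derive1_monomial N (z : cplx R) :
  cabs (derive1 (fun z : cplx R => z ^+ N) z) = N%:R * cabs z ^+ N.-1.
Proof.
rewrite exp_derive1 /GRing.scale/= cabsM cabsX cabsMn /cabs.
by rewrite Normc.normc1.
Qed.

(** With v = 1 - r, use 1 - r^2 <= 2 v, r^(N - 1) <= exp (- (N - 1) v) <= e exp (- N v) and (N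
    v)^beta <= beta^beta exp (N v); the exponentials cancel. *)
Lemma weighted_monomial_le (beta r : R) N : 0 < beta -> (0 < N)%N -> 0 <= r < 1 ->
  (1 - r ^+ 2) `^ beta * (N%:R * r ^+ N.-1) <=
  2 `^ beta * expR 1 * beta `^ beta * N%:R `^ (1 - beta).
Proof.
move=> b0 N0 /andP[r0 r1]; set v := 1 - r.
have v0 : 0 < v by rewrite subr_gt0.
have Nr0 : 0 < N%:R :> R by rewrite ltr0n.
have h1 : (1 - r ^+ 2) `^ beta <= 2 `^ beta * v `^ beta.
  rewrite -powRM ?(ltW v0)// ge0_ler_powR ?nnegrE ?(ltW b0)//.
  - by rewrite subr_ge0 expr_le1 ?(ltW r1).
  - by rewrite mulr_ge0 ?(ltW v0).
  - rewrite /v; nra.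
have h2 : r ^+ N.-1 <= expR 1 * expR (- (N%:R * v)).
  apply: (@le_trans _ _ (expR (- v) ^+ N.-1)).
    rewrite lerXn2r ?nnegrE ?expR_ge0//.
    by apply: le_trans (expR_ge1Dx _); rewrite /v; lra.
  rewrite -expRM_natl -expRD ler_expR -[in X in _ <= X](prednK N0) -natr1.
  have : v <= 1 by rewrite /v; lra.
  lra.
have h3 : v `^ beta * N%:R `^ beta <= beta `^ beta * expR (N%:R * v).
  rewrite -powRM ?(ltW v0)// mulrC [N%:R * v]mulrC mulrC.
  by apply: powR_le_expR => //; rewrite mulr_ge0 ?(ltW v0).
have E0 := expR_gt0 (N%:R * v).
have P0 : 0 < N%:R `^ beta :> R by rewrite powR_gt0.
rewrite powRB ?(gt_eqF Nr0) ?implybT// powRr1 ?(ltW Nr0)// mulrA [leRHS]mulrA.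
rewrite ler_pdivlMr//.
apply: (@le_trans _ _ ((2 `^ beta * v `^ beta) * (N%:R *
    (expR 1 * expR (- (N%:R * v)))) * N%:R `^ beta)).
  rewrite ler_wpM2r ?(ltW P0)// -[leLHS]mulrA.
  apply: ler_pM => //; rewrite ?powR_ge0 ?mulr_ge0 ?exprn_ge0 ?(ltW Nr0)//.
  by rewrite ler_wpM2l ?(ltW Nr0).
rewrite expRN.
rewrite [leLHS](_ : _ = (2 `^ beta * N%:R * expR 1 / expR (N%:R * v)) *
   (v `^ beta * N%:R `^ beta)); last by ring.
apply: (le_trans (ler_wpM2l _ h3)).
  by rewrite !mulr_ge0 ?invr_ge0 ?powR_ge0 ?expR_ge0.
rewrite le_eqVlt; apply/orP; left; apply/eqP; field.
by rewrite gt_eqF.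
Qed.

Lemma bloch_norm_monomial (beta : R) N : 0 < beta -> (0 < N)%N ->
  (bloch_norm beta (fun z : cplx R => z ^+ N)%R <=
   (2 `^ beta * expR 1 * beta `^ beta * N%:R `^ (1 - beta))%:E)%E.
Proof.
move=> b0 N0; rewrite /bloch_norm expr0n (gtn_eqF N0) cabs0 add0e.
apply: ge_ereal_sup => _ [z zD <-]; rewrite lee_fin cabs_derive1_monomial.
by apply: weighted_monomial_le => //; rewrite cabs_ge0.
Qed.

Lemma bloch_monomial (beta : R) N : 0 < beta -> (0 < N)%N ->
  bloch beta (fun z : cplx R => z ^+ N).
Proof.
move=> b0 N0; split; first by move=> z _; exact: exprn_derivable.
have := bloch_norm_monomial b0 N0.
rewrite /bloch_norm expr0n (gtn_eqF N0) cabs0 add0e.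
by move=> /le_lt_trans; apply; rewrite ltry.
Qed.
End monomial.

(** * Lower bound for the derivative of a series with nonnegative coefficients *)

Section derivative_lower_bound.
Context {R : realType}.
Implicit Types b h x : R.

Lemma ofRM x y : ofR (x * y) = ofR x * ofR y. Proof. exact: rmorphM. Qed.
Lemma ofRD x y : ofR (x + y) = ofR x + ofR y. Proof. exact: rmorphD. Qed.
Lemma ofRB x y : ofR (x - y) = ofR x - ofR y. Proof. exact: rmorphB. Qed.
Lemma ofRV x : ofR x^-1 = (ofR x)^-1. Proof. exact: fmorphV. Qed.
Lemma ofRX x n : ofR (x ^+ n) = ofR x ^+ n. Proof. exact: rmorphXn. Qed.
Lemma ofR_sum (I : Type) (s : seq I) (P : pred I) (F : I -> R) :
  ofR (\sum_(i <- s | P i) F i) = \sum_(i <- s | P i) ofR (F i).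
Proof. exact: rmorph_sum. Qed.

Lemma series_ofR (u : nat -> R) n :
  series (fun k => ofR (u k)) n = ofR (series u n).
Proof. by rewrite /series/= ofR_sum. Qed.

(** Convexity of x^(n + 1) on the nonnegative reals. The induction multiplies by h + b and discards
    (n + 1) b^n h^2. *)
Lemma tangent_le_expr b h n : 0 <= b -> 0 <= h ->
  n.+1%:R * b ^+ n * h <= (h + b) ^+ n.+1 - b ^+ n.+1.
Proof.
move=> b0 h0; elim: n => [|n IHn]; first by rewrite !expr1 expr0; lra.
rewrite [in leRHS]exprS [b ^+ n.+2]exprS.
move: IHn; rewrite -(natr1 n.+1) -[n.+1%:R in X in _ -> X]natr1 -natr1.
have : 0 <= (n%:R + 1) * b ^+ n * h ^+ 2.
  by rewrite !mulr_ge0 ?exprn_ge0 ?addr_ge0.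
move: (exprn_ge0 n b0); rewrite (exprS b).
move: (b ^+ n) ((h + b) ^+ n.+1) (n%:R : R) => B H N B0 k IHn.
have := ler_wpM2l (addr_ge0 h0 b0) IHn; lra.
Qed.

Lemma ofR_cvg_right0 : ofR h @[h --> (0 : R)^'+] --> (0 : cplx R)^'.
Proof.
move=> A [e /= e0 eA].
(* Radii of balls live in [R[i]], where being positive forces the imaginary part to vanish. *)
have eE : e = ofR (complex.Re e).
  by case: e e0 {eA} => x y; rewrite ltcE/= => /andP[/eqP -> _].
have e0' : 0 < complex.Re e by rewrite -ofR_lt -eE.
suff : \forall h \near (0 : R)^'+, A (ofR h) by [].
near=> h.
have h0 : 0 < h by near: h; exact: nbhs_right_gt.
apply: eA => /=; last by rewrite gt_eqF // (ofR_lt 0).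
rewrite sub0r normrN -cabsE cabs_ofR ?(ltW h0)// eE ofR_lt.
by near: h; exact: nbhs_right_lt.
Unshelve. all: by end_near. Qed.

Lemma cvg_derive1 (g : cplx R -> cplx R) (z : cplx R) : derivable g z 1 ->
  (fun h : cplx R => h^-1 *: (g (h + z) - g z)) @ 0^' --> derive1 g z.
Proof.
rewrite /derivable/derive1 => gz.
suff <- : (fun h : cplx R => h^-1 *: ((g \o shift z) (h *: 1) - g z)) =
  (fun h : cplx R => h^-1 *: (g (h + z) - g z)) by [].
by apply/funext => h; rewrite /= [h *: 1]mulr1.
Qed.

(* Comparing difference quotients along the real axis avoids differentiating
   the power series term by term. *)
Lemma derive1_power_series_ge (m : nat -> R) (g : cplx R -> cplx R) b P :
  (forall n, 0 <= m n) -> power_series_on_disc (fun n => ofR (m n)) g ->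
  0 <= b < 1 -> derivable g (ofR b) 1 ->
  \sum_(0 <= n < P) m n.+1 * (n.+1%:R * b ^+ n) <= cabs (derive1 g (ofR b)).
Proof.
move=> m0 gE /andP[b0 b1] /cvg_derive1 dg.
pose q (h : R) := (ofR h)^-1 *: (g (ofR h + ofR b) - g (ofR b)).
(* It suffices to bound the quotient for each small real h > 0, and then, h being fixed, its partial
   sums. *)
apply: (@cvg_cabs_ge _ _ ((0 : R)^'+) _ q _ _ (cvg_comp _ _ ofR_cvg_right0 dg)).
near=> h; rewrite /q.
have h0 : 0 < h by near: h; exact: nbhs_right_gt.
have hb1 : h + b < 1.
  by rewrite -ltrBrDr; near: h; apply: nbhs_right_lt; rewrite subr_gt0.
have hb0 : 0 <= h + b by rewrite addr_ge0 ?(ltW h0).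
have gx x : 0 <= x -> x < 1 ->
    ofR (series (fun n => m n * x ^+ n) k) @[k --> \oo] --> g (ofR x).
  move=> x0 x1.
  have xD : disc R (ofR x) by rewrite /disc/mkset cabs_ofR.
  have := gE _ xD.
  rewrite (_ : (fun k => _) = (fun k => ofR (m k * x ^+ k))).
    by rewrite (_ : series _ = (fun k => ofR (series (fun n => m n * x ^+ n) k)))//;
       apply/funext => k; rewrite series_ofR.
  by apply/funext => k; rewrite ofRM ofRX.
rewrite -ofRD.
set s := fun x : R => series (fun n => m n * x ^+ n).
have cq : (ofR h)^-1 *: (ofR (s (h + b) k) - ofR (s b k)) @[k --> \oo] -->
    (ofR h)^-1 *: (g (ofR (h + b)) - g (ofR b)).
  have cB : ofR (s (h + b) k) - ofR (s b k) @[k --> \oo] -->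
      g (ofR (h + b)) - g (ofR b).
    exact: (cvgB (gx _ hb0 hb1) (gx _ b0 b1)).
  exact: (@cvgZl_tmp _ _ _ _ _ (ofR h)^-1 _ _ cB).
apply: (@cvg_cabs_ge _ _ \oo _ _ _ _ cq); near=> k.
have Pk : (P < k)%N by near: k; exact: nbhs_infty_gt.
have -> : (ofR h)^-1 *: (ofR (s (h + b) k) - ofR (s b k)) =
    ofR (h^-1 * (s (h + b) k - s b k)) by rewrite ofRM ofRV ofRB.
have mono n : 0 <= m n * (h + b) ^+ n - m n * b ^+ n.
  rewrite -mulrBr mulr_ge0// subr_ge0 lerXn2r ?nnegrE//.
  by rewrite lerDr ltW.
have sB : s (h + b) k - s b k =
    \sum_(0 <= n < k) (m n * (h + b) ^+ n - m n * b ^+ n) by rewrite sumrB.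
rewrite sB cabs_ofR; last by rewrite mulr_ge0 ?invr_ge0 ?(ltW h0)// sumr_ge0.
rewrite mulrC ler_pdivlMr// mulr_suml.
(* Drop the nonnegative terms of index above P and the one of index 0; the shifted remainder is
   compared term by term with the tangents at b. *)
rewrite [leRHS](@big_cat_nat _ _ _ P.+1)//=; apply: ler_wpDr; first by rewrite sumr_ge0.
rewrite big_nat_recl//= ler_wpDl//; apply: ler_sum => n _.
rewrite -mulrBr -mulrA ler_wpM2l//.
exact: tangent_le_expr (ltW h0).
Unshelve. all: by end_near. Qed.
End derivative_lower_bound.

(** * Moments and tails of the measure *)

Section moments.
Context {R : realType} (mu : {measure set (measurableTypeR R) -> \bar R}).
Variable alpha : R.
Hypothesis alpha_gt0 : 0 < alpha.

Let coef n := Gamma (n%:R + alpha) / (n`!%:R * Gamma alpha).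

Let coef_gt0 n : 0 < coef n.
Proof.
by rewrite divr_gt0 ?mulr_gt0 ?Gamma_gt0 ?ltr0n ?fact_gt0// ltr_wpDl.
Qed.

(** Restrict the integral to [b, 1), where t^(n + k) >= b^(n + k). *)
Lemma moment_ge b n k : 0 <= b < 1 ->
  ((Gamma (n%:R + alpha) / (n`!%:R * Gamma alpha) * b ^+ (n + k))%:E *
     mu `[b, 1%R[%classic <= moment mu alpha n k)%E.
Proof.
move=> /andP[b0 b1]; rewrite -/(coef n).
have mc (D : set (measurableTypeR R)) :
    measurable_fun D (fun t => (coef n * t ^+ (n + k))%:E).
  by apply/measurable_EFinP; apply: measurable_funM => //; exact: measurable_funX.
apply: (@le_trans _ _ (\int[mu]_(t in `[b, 1%R[) (coef n * t ^+ (n + k))%:E)%E).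
  rewrite -integral_cst//; apply: ge0_le_integral => //=.
  - by move=> t _; rewrite lee_fin mulr_ge0 ?exprn_ge0// ltW.
  - move=> t; rewrite in_itv/= => /andP[bt _].
    by rewrite lee_fin ler_wpM2l ?(ltW (coef_gt0 n))// lerXn2r ?nnegrE// (le_trans b0).
apply: ge0_subset_integral => //=.
- move=> t; rewrite in_itv/= => /andP[t0 _].
  by rewrite lee_fin mulr_ge0 ?exprn_ge0// ltW.
- by apply: subset_itv; rewrite bnd_simp.
Qed.

Lemma moment_ge0 n k : (0 <= moment mu alpha n k)%E.
Proof.
have b01 : 0 <= (0 : R) < 1 by rewrite lexx ltr01.
apply: le_trans (moment_ge n k b01); rewrite mule_ge0//.
by rewrite lee_fin mulr_ge0 ?exprn_ge0// ltW// coef_gt0.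
Qed.

Lemma moment_lty_finite : (moment mu alpha 0 0 < +oo)%E ->
  (mu `[0%R, 1%R[%classic < +oo)%E.
Proof.
have b01 : 0 <= (0 : R) < 1 by rewrite lexx ltr01.
move=> /(le_lt_trans (moment_ge 0 0 b01)).
rewrite -/(coef 0) expr0 mulr1.
(* Since [coef 0] is positive, infinite mass would make the moment infinite. *)
have := measure_ge0 mu `[0%R, 1%R[%classic.
case: (mu _) => [r _ _|_|//]; first by rewrite ltry.
by rewrite gt0_muley// lte_fin.
Qed.

(** [fine] sends infinity to 0, so the real inequality requires both the tail and the moment to be
    finite. *)
Lemma fine_moment_ge b n k : 0 <= b < 1 -> (moment mu alpha 0 0 < +oo)%E ->
  (moment mu alpha n k < +oo)%E ->
  Gamma (n%:R + alpha) / (n`!%:R * Gamma alpha) * b ^+ (n + k) *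
    fine (mu `[b, 1%R[%classic) <= fine (moment mu alpha n k).
Proof.
move=> b01 /moment_lty_finite mu0 mnk.
have /andP[b0 b1] := b01.
have mub : mu `[b, 1%R[%classic \is a fin_num.
  rewrite ge0_fin_numE//; apply: le_lt_trans mu0.
  by apply: le_measure; rewrite ?inE//; apply: subset_itv; rewrite bnd_simp.
have cb0 : 0 <= coef n * b ^+ (n + k) by rewrite mulr_ge0 ?exprn_ge0// ltW.
have H := moment_ge n k b01.
by rewrite -lee_fin EFinM !fineK// ge0_fin_numE// moment_ge0.
Qed.

End moments.

(** * The Hankel operator on monomials and the resulting tail estimate *)

Section hankel_monomial.
Context {R : realType} (mu : {measure set (measurableTypeR R) -> \bar R}).
Variables alpha beta gamma : R.
Hypotheses (alpha_gt0 : 0 < alpha) (beta_gt0 : 0 < beta).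

Let delta N : nat -> cplx R := fun k => (k == N)%:R.

(** Each inner series collapses to its term k = N; convergence of the outer series is part of
    [hankel_defined]. *)
Lemma hankel_monomial N : hankel_defined mu alpha (delta N) ->
  power_series_on_disc (fun n => ofR (fine (moment mu alpha n N)))
    (hankel mu alpha (delta N)).
Proof.
move=> [_ _ + _] z zD => /(_ z zD).
rewrite /hankel /hankel_outer.
suff -> : (fun n => limn (hankel_inner mu alpha (delta N) n) * z ^+ n) =
  (fun n => ofR (fine (moment mu alpha n N)) * z ^+ n) by [].
apply/funext => n; congr (_ * _); apply: cvg_lim => //.
exact: (@cvg_series_single R (fun k => ofR (fine (moment mu alpha n k)))).
Qed.

Lemma bloch_seminorm_ge0 b (f : cplx R -> cplx R) : (0 <= bloch_seminorm b f)%E.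
Proof.
apply: (@le_trans _ _ ((1 - cabs (0 : cplx R) ^+ 2) `^ b * cabs (derive1 f 0))%:E).
  by rewrite lee_fin mulr_ge0 ?powR_ge0 ?cabs_ge0.
by apply: ereal_sup_ubound; exists 0 => //; rewrite /disc/mkset cabs0.
Qed.

Lemma bloch_norm_ge0 b (f : cplx R -> cplx R) : (0 <= bloch_norm b f)%E.
Proof. by rewrite adde_ge0 ?lee_fin ?cabs_ge0 ?bloch_seminorm_ge0. Qed.

Lemma weighted_derive1_le_bloch_norm b (f : cplx R -> cplx R) z : disc R z ->
  (((1 - cabs z ^+ 2) `^ b * cabs (derive1 f z))%:E <= bloch_norm b f)%E.
Proof.
move=> zD; apply: (@le_trans _ _ (bloch_seminorm b f)).
  by apply: ereal_sup_ubound; exists z.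
by rewrite leeDr// lee_fin cabs_ge0.
Qed.

(** Well-definedness on the single function z already makes every moment finite. *)
Lemma hankel_bounded_finite : hankel_bounded mu alpha beta gamma ->
  (mu `[0%R, 1%R[%classic < +oo)%E.
Proof.
move=> [M HM].
have [[mom _ _ _] _ _] := HM _ _ (bloch_monomial beta_gt0 (ltn0Sn 0))
  (@monomial_power_series R 1).
exact: (moment_lty_finite alpha_gt0 (mom 0 0)).
Qed.

Lemma hankel_bounded_tail : hankel_bounded mu alpha beta gamma ->
  exists2 C : R, 0 < C & forall N b, (0 < N)%N -> 0 <= b < 1 ->
    b ^+ N.+1 * fine (mu `[b, 1%R[%classic) <=
    C * (1 - b ^+ 2) `^ (alpha + 1 - gamma) * N%:R `^ (1 - beta).
Proof.
move=> [M HM].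
set K := 2 `^ beta * expR 1 * beta `^ beta.
have K0 : 0 < K by rewrite !mulr_gt0 ?powR_gt0 ?expR_gt0.
have G0 := Gamma_gt0 alpha_gt0.
(* [M] carries no sign condition; this is a positive operator bound. *)
have M0 : 0 < `|M| + 1 by rewrite ltr_wpDl.
exists (expR 2 * Gamma alpha * ((`|M| + 1) * K)).
  exact: (mulr_gt0 (mulr_gt0 (expR_gt0 2) G0) (mulr_gt0 M0 K0)).
move=> N b N0 b01; have /andP[b0 b1] := b01.
have [df [hg _] hM] := HM _ _ (bloch_monomial beta_gt0 N0)
  (@monomial_power_series R N).
rewrite -/(delta N) in df hg hM.
have [mom _ _ _] := df.
have bD : disc R (ofR b) by rewrite /disc/mkset cabs_ofR.
set g := hankel mu alpha (delta N) in hg hM.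
set m := fun n => fine (moment mu alpha n N).
have m0 n : 0 <= m n by exact: fine_ge0 (moment_ge0 mu alpha_gt0 n N).
set D := 1 - b ^+ 2.
have D0 : 0 < D by rewrite subr_gt0 expr_lt1.
have Nb0 : 0 <= N%:R `^ (1 - beta) :> R by exact: powR_ge0.
have gb : D `^ gamma * cabs (derive1 g (ofR b)) <=
    (`|M| + 1) * K * N%:R `^ (1 - beta).
  rewrite -lee_fin.
  have -> : D = 1 - cabs (ofR b) ^+ 2 by rewrite cabs_ofR.
  apply: (le_trans (weighted_derive1_le_bloch_norm gamma g bD)).
  apply: (le_trans hM).
  apply: (@le_trans _ _ ((`|M| + 1)%:E * bloch_norm beta (fun z : cplx R => z ^+ N)%R)%E).
    rewrite lee_wpmul2r ?bloch_norm_ge0// lee_fin.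
    by rewrite (le_trans (ler_norm _))// lerDl.
  rewrite -mulrA EFinM lee_wpmul2l ?lee_fin ?addr_ge0//.
  exact: bloch_norm_monomial.
(* The factors independent of n: b^(n + 1 + N) from the moment and b^n from the derivative give b^(N
   + 1) (b^2)^n, hence y = b^2 in the Gamma series. *)
set kappa := b ^+ N.+1 * fine (mu `[b, 1%R[%classic) / Gamma alpha.
have kappa0 : 0 <= kappa.
  by rewrite divr_ge0 ?(ltW G0)// mulr_ge0 ?exprn_ge0// fine_ge0.
pose X n : R := Gamma (n.+1%:R + alpha) / n`!%:R * (b ^+ 2) ^+ n.
have X0 n : 0 <= X n.
  by rewrite mulr_ge0 ?exprn_ge0 ?divr_ge0// ltW// Gamma_gt0// ltr_wpDl.
have sumX P : kappa * \sum_(0 <= n < P) X n <= cabs (derive1 g (ofR b)).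
  apply: le_trans (derive1_power_series_ge P m0 (hankel_monomial df) b01 (hg _ bD)).
  rewrite mulr_sumr; apply: ler_sum => n _.
  have := fine_moment_ge alpha_gt0 b01 (mom 0 0) (mom n.+1 N).
  rewrite -/(m n.+1) => /(ler_wpM2r (mulr_ge0 (ler0n _ n.+1) (exprn_ge0 n b0))).
  apply: le_trans.
  rewrite le_eqVlt; apply/orP; left; apply/eqP.
  rewrite /kappa /X factS natrM exprAC addSn !exprS exprD.
  by field; rewrite nat1r !pnatr_eq0 -lt0n fact_gt0 (gt_eqF G0).
have y01 : 0 <= b ^+ 2 < 1 by rewrite exprn_ge0//= expr_lt1.
have : ((kappa * (expR (- 2) * (D^-1) `^ (alpha + 1)))%:E <=
    (cabs (derive1 g (ofR b)))%:E)%E.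
  rewrite EFinM; apply: (le_trans (lee_wpmul2l _ (Gamma_series_ge alpha_gt0 y01))).
    by rewrite lee_fin.
  rewrite -nneseriesZl; last by move=> n _; rewrite lee_fin X0.
  apply: lime_le.
    by apply: is_cvg_nneseries => n _ _; rewrite mule_ge0// lee_fin X0.
  apply: nearW => P; under eq_bigr do rewrite -EFinM.
  by rewrite sumEFin lee_fin -mulr_sumr sumX.
rewrite lee_fin => H.
have {H gb} := le_trans (ler_wpM2l (powR_ge0 D gamma) H) gb.
have -> : D^-1 `^ (alpha + 1) = (D `^ (alpha + 1))^-1.
  by rewrite -(powR_inv1 (ltW D0)) -powRrM mulN1r powRN.
rewrite powRB ?(gt_eqF D0) ?implybT//.
have Dg := powR_gt0 gamma D0; have Da := powR_gt0 (alpha + 1) D0.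
have E0 := expR_gt0 (2 : R).
rewrite expRN /kappa => H.
(* Multiplying by e^2 Gamma(alpha) D^(alpha + 1) / D^gamma isolates the tail of mu. *)
have := ler_wpM2l (ltW (mulr_gt0 (mulr_gt0 E0 G0) (divr_gt0 Da Dg))) H.
rewrite [leLHS](_ : _ = b ^+ N.+1 * fine (mu `[b, 1%R[%classic)); last first.
  by field; rewrite !gt_eqF.
by move=> /le_trans; apply; rewrite le_eqVlt; apply/orP; left; apply/eqP; ring.
Qed.
End hankel_monomial.

(** * From tail estimates to the Carleson condition *)

(** For t >= 1 / 2 use 1 - t^2 <= 2 (1 - t); for t < 1 / 2, (2 (1 - t))^s >= 1 and the total mass is
    a sufficient constant. *)
Lemma carleson_of_tail (R : realType) (s C : R)
    (mu : {measure set (measurableTypeR R) -> \bar R}) :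
  0 < s -> (mu `[0%R, 1%R[%classic < +oo)%E ->
  (forall b, 1 / 2 <= b < 1 -> fine (mu `[b, 1%R[%classic) <= C * (1 - b ^+ 2) `^ s) ->
  carleson s mu.
Proof.
move=> s0 mu_fin tail; set m := fine (mu `[0%R, 1%R[%classic).
have s2 : 0 < 2 `^ s :> R by rewrite powR_gt0.
have m0 : 0 <= m by exact: fine_ge0.
(* [|C|] serves t >= 1 / 2, m serves t < 1 / 2, and 1 ensures positivity. *)
exists (2 `^ s * (`|C| + m + 1)).
  by rewrite mulr_gt0// ltr_wpDl// addr_ge0.
move=> t /andP[t0 t1].
have mut : (mu `[t, 1%R[%classic <= mu `[0%R, 1%R[%classic)%E.
  by apply: le_measure; rewrite ?inE//; apply: subset_itv; rewrite bnd_simp.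
have t10 : 0 <= 1 - t by rewrite subr_ge0 ltW.
have p0 : 0 <= 2 `^ s * (1 - t) `^ s by rewrite mulr_ge0 ?powR_ge0.
rewrite -(@fineK _ (mu `[t, 1%R[%classic)); last first.
  by rewrite ge0_fin_numE// (le_lt_trans mut).
rewrite lee_fin mulrAC.
have [th|ht] := ltP t (1 / 2).
  apply: (@le_trans _ _ m).
    by apply: fine_le; rewrite // ge0_fin_numE// (le_lt_trans mut).
  have h1 : 1 <= 2 `^ s * (1 - t) `^ s.
    rewrite -powRM// [leLHS](_ : 1 = 1 `^ s); last by rewrite powR1.
    rewrite ge0_ler_powR ?nnegrE ?mulr_ge0 ?(ltW s0)//.
    lra.
  have := normr_ge0 C; nra.
apply: (@le_trans _ _ (`|C| * (2 `^ s * (1 - t) `^ s))).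
  rewrite -powRM//; apply: (le_trans (tail t _)); first by rewrite ht.
  apply: (@le_trans _ _ (`|C| * (1 - t ^+ 2) `^ s)).
    by rewrite ler_wpM2r ?powR_ge0 ?ler_norm.
  rewrite ler_wpM2l// ge0_ler_powR ?nnegrE ?mulr_ge0 ?(ltW s0)//.
    by rewrite subr_ge0 expr_le1 ?(ltW t1).
  nra.
rewrite mulrC ler_wpM2l//; lra.
Qed.

(** With D = 1 - b^2 <= 3 / 4, b >= exp (- 4 D) and 4 D (N + 1) <= 4 + 8 D <= 10, so 12 leaves some
    room. *)
Lemma expr_ge_expRN12 (R : realType) (b : R) N : 1 / 2 <= b < 1 ->
  N%:R <= (1 - b ^+ 2)^-1 + 1 -> expR (- 12) <= b ^+ N.+1.
Proof.
move=> /andP[hb b1] NE; have b0 : 0 <= b by lra.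
set D := 1 - b ^+ 2 in NE *.
have D0 : 0 < D by rewrite subr_gt0 expr_lt1.
have D34 : D <= 3 / 4 by rewrite /D; nra.
(* Here 1 / b <= 1 + 4 D, because 1 - b <= D <= 4 D b when b >= 1 / 2. *)
have bD : expR (- (4 * D)) <= b.
  rewrite expRN invf_ple ?posrE ?expR_gt0//; last lra.
  apply: le_trans (expR_ge1Dx _).
  rewrite -[b^-1]mul1r ler_pdivrMr; last lra.
  have -> : 1 = D + b ^+ 2 by rewrite /D; ring.
  have : D <= 2 * (1 - b) by rewrite /D; nra.
  have : b ^+ 2 <= b by nra.
  rewrite /D; nra.
apply: (@le_trans _ _ (expR (- (4 * D)) ^+ N.+1)); last first.
  by rewrite lerXn2r ?nnegrE ?expR_ge0.
rewrite -expRM_natl ler_expR -natr1.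
have : D * N%:R <= D * (D^-1 + 1) by rewrite ler_pM2l.
by rewrite mulrDr divff ?gt_eqF//; lra.
Qed.

Theorem theorem3p1 (R : realType) (alpha beta gamma : R)
    (mu : {measure set (measurableTypeR R) -> \bar R})
    (alpha_gt0 : 0 < alpha) (beta_gt0 : 0 < beta) (gamma_gt0 : 0 < gamma)
    (Hbounded : hankel_bounded mu alpha beta gamma) :
  (1 < beta ->
     (0 < alpha + beta - gamma - 1 / 2 ->
        carleson (alpha + beta - gamma - 1 / 2) mu) /\
     (alpha + beta - gamma - 1 / 2 = 0 -> (mu `[0%R, 1%R[%classic < +oo)%E)) /\
  (0 < beta < 1 ->
     (0 < alpha - gamma + 1 / 2 -> carleson (alpha - gamma + 1 / 2) mu) /\
     (alpha - gamma + 1 / 2 = 0 -> (mu `[0%R, 1%R[%classic < +oo)%E)).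
Proof.
have mu_fin := hankel_bounded_finite alpha_gt0 beta_gt0 Hbounded.
have [C C0 tail] := hankel_bounded_tail alpha_gt0 beta_gt0 Hbounded.
have D01 (b : R) : 1 / 2 <= b < 1 -> 0 < 1 - b ^+ 2 <= 1.
  by move=> /andP[hb b1]; rewrite subr_gt0 lerBlDr lerDl exprn_ge0 ?expr_lt1//; lra.
have mu0 (b : R) : 0 <= fine (mu `[b, 1%R[%classic) by exact: fine_ge0.
(* Both finiteness claims are [mu_fin]; the two Carleson claims remain. *)
split=> [beta1|_]; split=> // s0.
- apply: (@carleson_of_tail _ _ (expR 12 * C) _ s0 mu_fin) => b hb.
  have /andP[D0 D1] := D01 _ hb; have /andP[hb2 b1] := hb.
  set D := 1 - b ^+ 2 in D0 D1 *.
  (* So 1 / D <= N <= 1 / D + 1: the lower bound controls N^(1 - beta), whose exponent is negative,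
     and the upper one keeps b^(N + 1) away from 0. *)
  pose N := (Num.truncn D^-1).+1.
  have b01 : 0 <= b < 1 by rewrite b1 andbT; lra.
  have Di0 : 0 <= D^-1 by rewrite invr_ge0 ltW.
  have DN : D^-1 <= N%:R by rewrite ltW// truncnS_gt.
  have ND : N%:R <= D^-1 + 1 by rewrite -natr1 lerD2r truncn_le.
  have bN := expr_ge_expRN12 hb ND.
  have NDp : N%:R `^ (1 - beta) <= D `^ (beta - 1).
    rewrite -[1 - beta]opprB powRN -[leLHS]mul1r ler_pdivrMr ?powR_gt0//.
    rewrite -powRM ?(ltW D0)// [leLHS](_ : 1 = 1 `^ (beta - 1)); last by rewrite powR1.
    rewrite ge0_ler_powR ?nnegrE ?mulr_ge0 ?(ltW D0)//; first lra.
    by rewrite -ler_pdivrMl// mulr1.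
  have := le_trans (ler_wpM2r (mu0 b) bN) (tail N b (ltn0Sn _) b01).
  rewrite expRN ler_pdivrMl ?expR_gt0// => /le_trans; apply.
  rewrite -!mulrA ler_wpM2l ?expR_ge0// ler_wpM2l ?(ltW C0)//.
  apply: (le_trans (ler_wpM2l (powR_ge0 _ _) NDp)).
  rewrite -powRD ?(gt_eqF D0) ?implybT//.
  (* As D <= 1, the exponent alpha + beta - gamma may be lowered by 1 / 2. *)
  by rewrite ger_powR ?D0//; lra.
- apply: (@carleson_of_tail _ _ (4 * C) _ s0 mu_fin) => b hb.
  have /andP[D0 D1] := D01 _ hb; have /andP[hb2 b1] := hb.
  have b01 : 0 <= b < 1 by rewrite b1 andbT; lra.
  (* For N = 1 the factor b^2 is at least 1 / 4, whence the constant 4 C. *)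
  have := tail 1 b (ltn0Sn _) b01; rewrite powR1 mulr1.
  have b4 : 1 / 4 <= b ^+ 2 by nra.
  move=> /(le_trans (ler_wpM2r (mu0 b) b4)) H.
  apply: (@le_trans _ _ (4 * (C * (1 - b ^+ 2) `^ (alpha + 1 - gamma)))); first lra.
  rewrite -mulrA ler_wpM2l// ler_wpM2l ?(ltW C0)//.
  by rewrite ger_powR ?D0//; lra.
Qed.
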